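(* Let $P_b$ be a $(K,f,Z_b,\mathcal{S}_b)$ PDA, and for $s\in\mathcal{S}_b$ let $g_s$ be the number of occurrences of $s$ in $P_b$. Let $P_\ast$ be an $(m,n,Z_\ast,\mathcal{S}_\ast)$ PDA. For $s\in\mathcal{S}_b$ and $t\in\{1,\dots,g_s\}$, let $P_{s,t}$ be an $(m,n,Z_c,\mathcal{S}_{s,t})$ PDA such that, for every $s$, the PDAs $P_{s,1},\dots,P_{s,g_s}$ are Blackburn-compatible with respect to $P_\ast$, and such that, for distinct $s,s'\in\mathcal{S}_b$, the sets $\mathcal{S}_{s,t}$ and $\mathcal{S}_{s',t'}$ are disjoint for all $t,t'$. Let $P_{\ast,r}$, $r\in[KZ_b]$, be integer-disjoint copies of $P_\ast$, with integer sets $\mathcal{S}_{\ast,r}$, which are also integer-disjoint from all the $P_{s,t}$. Let $P$ be the array obtained from $P_b$ by replacing the $r$-th $\ast$ of $P_b$ by $P_{\ast,r}$ for $r\in[KZ_b]$, and replacing the $t$-th occurrence of the integer $s\in\mathcal{S}_b$ by $P_{s,t}$ for $t=1,\dots,g_s$ (with respect to some fixed orderings of the $\ast$'s and of the occurrences of each integer). Then $P$ is a $(Km,\,fn,\,Z_bZ_\ast+(f-Z_b)Z_c,\,\mathcal{S})$ PDA, where $$\mathcal{S}=\Big(\bigcup_{r\in[KZ_b]}\mathcal{S}_{\ast,r}\Big)\cup\Big(\bigcup_{s\in\mathcal{S}_b}\bigcup_{t=1}^{g_s}\mathcal{S}_{s,t}\Big).$$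
   Context: Notation: $[n]=\{0,1,\dots,n-1\}$. For positive integers $K,f$, a nonnegative integer $Z$ and a finite set $\mathcal{S}$ of integers, a $(K,f,Z,\mathcal{S})$ placement delivery array (PDA) is an $f\times K$ array $P=[p_{j,k}]$ ($f$ rows, $K$ columns), $j\in[f]$, $k\in[K]$, with entries in $\mathcal{S}\cup\{\ast\}$ such that: (C1) $\ast$ appears exactly $Z$ times in each column; (C2) each $s\in\mathcal{S}$ occurs at least once; (C3, Blackburn property) if two distinct cells $(j_1,k_1)$, $(j_2,k_2)$ contain the same integer then $p_{j_1,k_2}=p_{j_2,k_1}=\ast$. Blackburn compatibility: let $P_0=[p^{(0)}_{ij}]$, $P_1=[p^{(1)}_{ij}]$, $P_\ast=[p^{(\ast)}_{ij}]$ be arrays of the same size. $P_0$ and $P_1$ are Blackburn-compatible w.r.t. $P_\ast$ if, whenever $p^{(0)}_{i_1j_1}=p^{(1)}_{i_2j_2}\neq\ast$, we have $p^{(\ast)}_{i_1j_2}=p^{(\ast)}_{i_2j_1}=\ast$. A family $P_0,\dots,P_{g-1}$ is Blackburn-compatible w.r.t. $P_\ast$ if $P_i,P_j$ are for all $i\neq j$. An integer-disjoint copy of a PDA is obtained by relabelling its integers injectively so that the resulting integer set is disjoint from the other integer sets under consideration. *)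

(* Defs.v *)
From mathcomp Require Export all_boot all_algebra.
From mathcomp Require Export finmap.
From mathcomp Require Export mxtens.

Set Implicit Arguments.
Unset Strict Implicit.
Unset Printing Implicit Defensive.

Local Open Scope nat_scope.

(* An a x b array (a rows, b columns) with entries in int together with the
   star symbol: None is the star, Some s is the integer s. *)
Definition array (a b : nat) := 'M[option int]_(a, b).

(* A (K, f, Z, S) placement delivery array has f rows and K columns. *)
Record is_pda (K f Z : nat) (S : {fset int}) (P : array f K) : Prop := IsPda {
  pda_K_gt0 : 0 < K;
  pda_f_gt0 : 0 < f;
  pda_entries : forall j k s, P j k = Some s -> s \in S;
  pda_star_count : forall k, #|[set j | P j k == None]| = Z;
  pda_all_occur : forall s, s \in S -> exists j k, P j k = Some s;
  pda_blackburn : forall j1 k1 j2 k2 s,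
    (j1, k1) <> (j2, k2) -> P j1 k1 = Some s -> P j2 k2 = Some s ->
    P j1 k2 = None /\ P j2 k1 = None
}.
Arguments is_pda : clear implicits.

Section Arrays.
Variables a b : nat.
Implicit Types P Q : array a b.

Definition star_cells P : {set 'I_a * 'I_b} := [set c | P c.1 c.2 == None].

Definition int_cells P (s : int) : {set 'I_a * 'I_b} :=
  [set c | P c.1 c.2 == Some s].

Definition occ P (s : int) : nat := #|int_cells P s|.

(* The cells (i1, j1) and (i2, j2) are not required to be distinct. *)
Definition blackburn_compatible (Pstar P0 P1 : array a b) : Prop :=
  forall i1 j1 i2 j2, P0 i1 j1 = P1 i2 j2 -> P0 i1 j1 <> None ->
    Pstar i1 j2 = None /\ Pstar i2 j1 = None.

Definition blackburn_family (I : eqType) (Pstar : array a b) (D : pred I)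
    (Q : I -> array a b) : Prop :=
  forall t t', D t -> D t' -> t <> t' ->
    blackburn_compatible Pstar (Q t) (Q t').

(* (P', S') arises from (P, S) by an injective relabelling of the integers. *)
Definition relabelled_copy P (S : {fset int}) P' (S' : {fset int}) : Prop :=
  exists phi : int -> int,
    [/\ {in S &, injective phi},
        S' = (phi @` S)%fset
      & P' = map_mx (omap phi) P].

End Arrays.

(* o lists every element of A exactly once. *)
Definition ordering (T : finType) (A : {set T}) (o : seq T) : Prop :=
  perm_eq o (enum A).

Section Compose.
Variables f K n m : nat.

(* The fn x Km array whose block in block-row j and block-column k is B j k:
   entry (x, y) is read off at block (x %/ n, y %/ m), cell (x %% n, y %% m). *)
Definition block_array (B : 'I_f -> 'I_K -> array n m) :
    array (f * n) (K * m) :=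
  (\matrix_(x, y) B (mxtens_unindex x).1 (mxtens_unindex y).1
                    (mxtens_unindex x).2 (mxtens_unindex y).2)%R.

(* Stars are numbered from 0 along star_ord; the occurrences of s are numbered
   from 1 along occ_ord s. *)
Definition pda_subst (Pb : array f K)
    (star_ord : seq ('I_f * 'I_K)) (occ_ord : int -> seq ('I_f * 'I_K))
    (Pst : nat -> array n m) (Pc : int -> nat -> array n m) :
    array (f * n) (K * m) :=
  block_array (fun j k =>
    match Pb j k with
    | None => Pst (index (j, k) star_ord)
    | Some s => Pc s (index (j, k) (occ_ord s)).+1
    end).

End Compose.

(* Main.v *)
(* By disjointness of the integer sets, an integer shared by two blocks of P can
   only come from blocks P_{s,t} and P_{s,t'} with the same s and t <> t'. The
   Blackburn property of P_b then makes the two opposite blocks copies of P_*,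
   and compatibility with respect to P_* puts stars in the relevant cells. *)
Require Import Defs.

Set Implicit Arguments.
Unset Strict Implicit.
Unset Printing Implicit Defensive.

Local Open Scope nat_scope.

(** Relabelling leaves the stars in place, and injectivity on [S] ensures that equal integers of the
    copy come from equal integers of [P]. *)
Lemma relabelled_copy_pda (a b Z : nat) (S S' : {fset int}) (P P' : array b a) :
  is_pda a b Z S P -> relabelled_copy P S P' S' -> is_pda a b Z S' P'.
Proof.
move=> [a_gt0 b_gt0 entP starP occP bbP] [phi [phi_inj -> ->]].
split=> // [j k s|k|s|j1 k1 j2 k2 s neq12]; rewrite ?mxE.
- by case Ejk: (P j k) => [u|] //= [<-]; rewrite in_imfset //=; apply: entP Ejk.
- rewrite -(starP k); apply: eq_card => j; rewrite !inE mxE.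
  by case: (P j k).
- case/imfsetP=> u /= /occP[j [k Ejk]] ->.
  by exists j, k; rewrite mxE Ejk.
- case E1: (P j1 k1) => [u1|] //= [<-].
  case E2: (P j2 k2) => [u2|] //= [eq_phi].
  have eq_u : u2 = u1 by apply: phi_inj eq_phi; [apply: entP E2 | apply: entP E1].
  rewrite eq_u in E2.
  by have [-> ->] := bbP _ _ _ _ _ neq12 E1 E2.
Qed.

(** Serves to count the stars in a column of a block array one block-row at a time; [mxtens_unindex]
    is a bijection onto pairs (block-row, inner row). *)
Lemma card_unindex_pair (f n : nat) (A : 'I_f -> {set 'I_n}) :
  #|[set x : 'I_(f * n) | (mxtens_unindex x).2 \in A (mxtens_unindex x).1]|
    = \sum_j #|A j|.
Proof.
rewrite -sum1_card (reindex (@mxtens_index f n)); last first.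
  exists (@mxtens_unindex f n) => p _.
    exact: mxtens_indexK.
  exact: mxtens_unindexK.
under eq_bigl => p do rewrite inE mxtens_indexK.
rewrite (eq_bigr (fun j => \sum_(i in A j) 1)) => [|j _]; last first.
  by rewrite sum1_card.
by rewrite pair_big_dep /=; apply: eq_bigl => -[j i].
Qed.

(** Gluing criterion: inside one block the Blackburn property is that of the block, so only cells of
    different blocks need a hypothesis. That hypothesis gives one opposite cell; exchanging the two
    cells gives the other. *)
Lemma block_array_pda (f K n m Z : nat) (S : {fset int})
    (z : 'I_f -> 'I_K -> nat) (T : 'I_f -> 'I_K -> {fset int})
    (B : 'I_f -> 'I_K -> array n m) :
  0 < f -> 0 < K ->
  (forall j k, is_pda m n (z j k) (T j k) (B j k)) ->
  (forall k, \sum_j z j k = Z) ->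
  (forall s, s \in S <-> exists j k, s \in T j k) ->
  (forall j1 k1 j2 k2 i1 l1 i2 l2 s, (j1, k1) <> (j2, k2) ->
     B j1 k1 i1 l1 = Some s -> B j2 k2 i2 l2 = Some s ->
     B j1 k2 i1 l2 = None) ->
  is_pda (K * m) (f * n) Z S (block_array B).
Proof.
move=> f_gt0 K_gt0 B_pda zZ memS B_cross.
(* The block at (0, 0) exists because [f] and [K] are positive; it supplies the positivity of [m]
   and [n]. *)
have [m_gt0 n_gt0 _ _ _ _] := B_pda (Ordinal f_gt0) (Ordinal K_gt0).
split=> [||x y s|y|s|x1 y1 x2 y2 s neq12]; rewrite ?muln_gt0 ?K_gt0 ?f_gt0 ?mxE //.
- by move=> Es; apply/memS; do 2!eexists; apply: (pda_entries (B_pda _ _)) Es.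
- rewrite -(zZ (mxtens_unindex y).1).
  under eq_bigr => j do
    rewrite -(pda_star_count (B_pda j _) (mxtens_unindex y).2).
  by rewrite -card_unindex_pair; apply: eq_card => x; rewrite !inE mxE.
- case/memS=> j [k /(pda_all_occur (B_pda j k))[i [l Es]]].
  exists (mxtens_index (j, i)), (mxtens_index (k, l)).
  by rewrite mxE !mxtens_indexK.
have: (mxtens_unindex x1, mxtens_unindex y1)
       <> (mxtens_unindex x2, mxtens_unindex y2).
  move/pair_equal_spec=> [exx eyy]; apply: neq12; congr (_, _).
    exact: can_inj (@mxtens_unindexK f n) _ _ exx.
  exact: can_inj (@mxtens_unindexK K m) _ _ eyy.
case: (mxtens_unindex x1) (mxtens_unindex x2) => [j1 i1] [j2 i2].
case: (mxtens_unindex y1) (mxtens_unindex y2) => [k1 l1] [k2 l2] /= neq E1 E2.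
have [eqb|/eqP neqb] := eqVneq (j1, k1) (j2, k2); last first.
  by split; [apply: B_cross E1 E2 | apply: B_cross E2 E1 => // /esym].
case: eqb neq E1 E2 => <- <- neq E1 E2.
by apply: (pda_blackburn (B_pda j1 k1)) E1 E2 => -[ei el]; apply: neq; rewrite ei el.
Qed.

Lemma card_star_cells (K f Z : nat) (S : {fset int}) (P : array f K) :
  is_pda K f Z S P -> #|star_cells P| = K * Z.
Proof.
move=> P_pda; rewrite -sum1_card.
transitivity (\sum_k \sum_(j | P j k == None) 1).
  rewrite pair_big_dep /= (reindex (fun p : 'I_K * 'I_f => (p.2, p.1))) /=.
    by apply: eq_bigl => p; rewrite inE.
  by exists (fun p => (p.2, p.1)) => -[].
transitivity (\sum_(k < K) Z); last by rewrite sum_nat_const card_ord.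
apply: eq_bigr => k _; rewrite -(pda_star_count P_pda k) -sum1_card.
by apply: eq_bigl => j; rewrite inE.
Qed.

Lemma mem_ordering (T : finType) (A : {set T}) (o : seq T) :
  ordering A o -> o =i A.
Proof. by move=> /perm_mem oA x; rewrite oA mem_enum. Qed.

Lemma size_ordering (T : finType) (A : {set T}) (o : seq T) :
  ordering A o -> size o = #|A|.
Proof. by move=> /perm_size->; rewrite -cardE. Qed.

Lemma index_ordering_lt (T : finType) (A : {set T}) (o : seq T) (x : T) :
  ordering A o -> x \in A -> index x o < #|A|.
Proof. by move=> oA xA; rewrite -(size_ordering oA) index_mem (mem_ordering oA). Qed.

Lemma index_ordering_inj (T : finType) (A : {set T}) (o : seq T) :
  ordering A o -> {in A &, injective (index^~ o)}.
Proof.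
move=> oA x y xA yA eq_xy.
have xo : x \in o by rewrite (mem_ordering oA).
by rewrite -(nth_index x xo) eq_xy nth_index // (mem_ordering oA).
Qed.

(** With the bound and the injectivity above, this makes [index] a bijection from [A] onto the
    numbers below [#|A|]; surjectivity is what makes every available block occur in the composed
    array. *)
Lemma ordering_indexP (T : finType) (A : {set T}) (o : seq T) (i : nat) :
  ordering A o -> i < #|A| -> exists2 x, x \in A & index x o = i.
Proof.
move=> oA; rewrite -(size_ordering oA) => lt_i.
case: o oA lt_i => // x0 o oA lt_i.
exists (nth x0 (x0 :: o) i); first by rewrite -(mem_ordering oA) mem_nth.
by rewrite index_uniq // (perm_uniq oA) enum_uniq.
Qed.

Theorem theorem12
  (K f Zb : nat) (Sb : {fset int}) (Pb : array f K)
  (m n Zs : nat) (Ss : {fset int}) (Ps : array n m)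
  (Zc : nat) (Sc : int -> nat -> {fset int}) (Pc : int -> nat -> array n m)
  (Sr : nat -> {fset int}) (Pr : nat -> array n m)
  (star_ord : seq ('I_f * 'I_K)) (occ_ord : int -> seq ('I_f * 'I_K))
  (Pb_pda : is_pda K f Zb Sb Pb)
  (Ps_pda : is_pda m n Zs Ss Ps)
  (Pc_pda : forall s t, s \in Sb -> 1 <= t <= occ Pb s ->
     is_pda m n Zc (Sc s t) (Pc s t))
  (Pc_compat : forall s, s \in Sb ->
     blackburn_family Ps (fun t : nat => 1 <= t <= occ Pb s) (Pc s))
  (Sc_disjoint : forall s s' t t', s \in Sb -> s' \in Sb -> s <> s' ->
     1 <= t <= occ Pb s -> 1 <= t' <= occ Pb s' ->
     [disjoint Sc s t & Sc s' t']%fset)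
  (Pr_copy : forall r, r < K * Zb -> relabelled_copy Ps Ss (Pr r) (Sr r))
  (Sr_disjoint : forall r r', r < K * Zb -> r' < K * Zb -> r <> r' ->
     [disjoint Sr r & Sr r']%fset)
  (Sr_Sc_disjoint : forall r s t, r < K * Zb -> s \in Sb ->
     1 <= t <= occ Pb s -> [disjoint Sr r & Sc s t]%fset)
  (star_ordP : ordering (star_cells Pb) star_ord)
  (occ_ordP : forall s, s \in Sb -> ordering (int_cells Pb s) (occ_ord s)) :
  is_pda (K * m) (f * n) (Zb * Zs + (f - Zb) * Zc)
    ((\bigcup_(r in 'I_(K * Zb)) Sr r) `|`
     (\bigcup_(s <- Sb) \bigcup_(t <- iota 1 (occ Pb s)) Sc s t))%fset
    (pda_subst Pb star_ord occ_ord Pr Pc).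
Proof.
have Pr_pda r : r < K * Zb -> is_pda m n Zs (Sr r) (Pr r).
  by move/Pr_copy; apply: relabelled_copy_pda.
(* Compatibility yields stars of [Ps], while the opposite blocks are copies of it; this carries the
   stars over. *)
have Pr_None r i l : r < K * Zb -> Ps i l = None -> Pr r i l = None.
  by move=> /Pr_copy[phi [_ _ ->]]; rewrite mxE => ->.
have star_lt j k : Pb j k = None -> index (j, k) star_ord < K * Zb.
  by move=> Ejk; rewrite -(card_star_cells Pb_pda) index_ordering_lt ?inE ?Ejk.
have entB j k s : Pb j k = Some s -> s \in Sb by apply: (pda_entries Pb_pda).
have occ_lt j k s :
    Pb j k = Some s -> 1 <= (index (j, k) (occ_ord s)).+1 <= occ Pb s.
  by move=> Ejk; rewrite /= index_ordering_lt ?inE ?Ejk //; apply/occ_ordP/entB/Ejk.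
(* The selector is generic in [A] so that one case analysis on [Pb] yields the block, its integer
   set and its number of stars per column. *)
pose blk A (U : nat -> A) (V : int -> nat -> A) (j : 'I_f) (k : 'I_K) :=
  match Pb j k with
  | None => U (index (j, k) star_ord)
  | Some s => V s (index (j, k) (occ_ord s)).+1
  end.
apply: (@block_array_pda _ _ _ _ _ _ (blk nat (fun=> Zs) (fun _ _ => Zc))
          (blk _ Sr Sc)).
- exact: pda_f_gt0 Pb_pda.
- exact: pda_K_gt0 Pb_pda.
- move=> j k; rewrite /blk; case Ejk: (Pb j k) => [s|].
    by apply: Pc_pda; [apply: entB Ejk | apply: occ_lt].
  exact/Pr_pda/star_lt.
(* Column [k] of [Pb] has [Zb] stars, whose blocks contribute [Zs] each; the remaining [f - Zb]
   blocks contribute [Zc] each. *)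
- move=> k; rewrite (bigID (fun j => Pb j k == None)) /=; congr (_ + _).
    rewrite (eq_bigr (fun=> Zs)); last by rewrite /blk => j /eqP->.
    by rewrite sum_nat_const -(pda_star_count Pb_pda k) cardsE.
  rewrite (eq_bigr (fun=> Zc)); last by rewrite /blk => j; case: (Pb j k).
  rewrite sum_nat_const; congr (_ * _); rewrite -(pda_star_count Pb_pda k).
  rewrite -[X in _ = X - _]card_ord -(cardsC [set j | Pb j k == None]) addKn.
  by apply: eq_card => j; rewrite !inE.
- move=> s; rewrite inE; split.
    case/orP.
      case/bigfcupP=> r _ sr.
      have [|[j k]] := @ordering_indexP _ _ _ r star_ordP.
        by rewrite (card_star_cells Pb_pda).
      rewrite inE /= => /eqP Ejk Er; exists j, k.
      by rewrite /blk Ejk Er.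
    (* Occurrences are numbered from 1, so number 0 is excluded and number [t.+1] sits at index [t]
       of [occ_ord u]. *)
    case/bigfcupP=> u; rewrite andbT => uSb /bigfcupP[[|t]];
      rewrite andbT mem_iota // add1n ltnS /= => t_lt st.
    have [[j k]] := ordering_indexP (occ_ordP _ uSb) t_lt.
    by rewrite inE /= => /eqP Ejk Et; exists j, k; rewrite /blk Ejk Et.
  case=> j [k]; rewrite /blk; case Ejk: (Pb j k) => [u|] su; apply/orP.
    right; apply/bigfcupP; exists u; first by rewrite andbT (entB _ _ _ Ejk).
    apply/bigfcupP; exists (index (j, k) (occ_ord u)).+1 => //.
    by rewrite andbT mem_iota add1n ltnS; apply: occ_lt.
  left; apply/bigfcupP; exists (Ordinal (star_lt _ _ Ejk)) => //.
  by rewrite ?mem_index_enum.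
move=> j1 k1 j2 k2 i1 l1 i2 l2 s neq.
have disjF (A B : {fset int}) : s \in A -> s \in B -> ~ [disjoint A & B]%fset.
  by move=> sA sB /fdisjointP/(_ _ sA); rewrite sB.
case E1: (Pb j1 k1) => [u1|]; case E2: (Pb j2 k2) => [u2|] F1 F2.
- have lt1 := occ_lt _ _ _ E1; have lt2 := occ_lt _ _ _ E2.
  have S1 := entB _ _ _ E1; have S2 := entB _ _ _ E2.
  have [eq_u|/eqP neq_u] := eqVneq u1 u2; last first.
    case: (disjF _ _ _ _ (Sc_disjoint _ _ _ _ S1 S2 neq_u lt1 lt2)).
      exact: pda_entries (Pc_pda _ _ S1 lt1) _ _ _ F1.
    exact: pda_entries (Pc_pda _ _ S2 lt2) _ _ _ F2.
  rewrite -{}eq_u {u2 S2} in E2 F2 lt2.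
  have [E12 _] := pda_blackburn Pb_pda neq E1 E2.
  rewrite E12; apply: Pr_None; first exact: star_lt.
  (* Compatibility is assumed only between different members of the family, so the two cells must
     have different occurrence numbers. *)
  have neq_t : (index (j1, k1) (occ_ord u1)).+1 <> (index (j2, k2) (occ_ord u1)).+1.
    case=> /(index_ordering_inj (occ_ordP _ S1)) eq12; apply: neq.
    by apply: eq12; rewrite inE /= ?E1 ?E2.
  have [|//] := Pc_compat _ S1 _ _ lt1 lt2 neq_t _ _ _ _ (etrans F1 (esym F2)).
  by rewrite F1.
- have S1 := entB _ _ _ E1; have lt1 := occ_lt _ _ _ E1; have lt2 := star_lt _ _ E2.
  case: (disjF _ _ _ _ (Sr_Sc_disjoint _ _ _ lt2 S1 lt1)).
    exact: pda_entries (Pr_pda _ lt2) _ _ _ F2.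
  exact: pda_entries (Pc_pda _ _ S1 lt1) _ _ _ F1.
- have S2 := entB _ _ _ E2; have lt2 := occ_lt _ _ _ E2; have lt1 := star_lt _ _ E1.
  case: (disjF _ _ _ _ (Sr_Sc_disjoint _ _ _ lt1 S2 lt2)).
    exact: pda_entries (Pr_pda _ lt1) _ _ _ F1.
  exact: pda_entries (Pc_pda _ _ S2 lt2) _ _ _ F2.
(* Two distinct stars have distinct indices, hence integer-disjoint copies, which cannot share
   [s]. *)
have lt1 := star_lt _ _ E1; have lt2 := star_lt _ _ E2.
have neq_r : index (j1, k1) star_ord <> index (j2, k2) star_ord.
  move/(index_ordering_inj star_ordP) => eq12; apply: neq.
  by apply: eq12; rewrite inE /= ?E1 ?E2.
case: (disjF _ _ _ _ (Sr_disjoint _ _ lt1 lt2 neq_r)).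
  exact: pda_entries (Pr_pda _ lt1) _ _ _ F1.
exact: pda_entries (Pr_pda _ lt2) _ _ _ F2.
Qed.
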